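(* Let $(E,\mathcal{E})$ be a countably generated measurable space whose diagonal $\Delta=\{(x,x): x\in E\}$ belongs to $\mathcal{E}\otimes\mathcal{E}$, and let $X=(X_n)_{n\in\mathbb{Z}_+}$ be a Markov chain with state space $(E,\mathcal{E})$ and $n$-step transition probabilities $P_n(x,dy)$, which has an invariant probability measure $\mu$. Assume further that for $\mu\otimes\mu$-almost all $(x,y)\in E\times E$ there exists $n=n_{x,y}\in\mathbb{N}$ such that $$P_n(x,\cdot)\not\perp P_n(y,\cdot).$$ Then for $\mu$-almost all $x\in E$ $$\|P_n(x,\cdot)-\mu\|\to 0,\quad n\to\infty.$$
   Context: The Markov chain is time-homogeneous in discrete time; $P(x,dy)$ denotes its one-step transition probability (a Markov kernel on $(E,\mathcal{E})$) and $P_n(x,dy)$ its $n$-step transition probability. An invariant probability measure for $X$ is a probability measure $\mu$ on $(E,\mathcal{E})$ with $\mu(dy)=\int_E P(x,dy)\,\mu(dx)$. Probability measures $\nu,\bar\nu$ on $(E,\mathcal{E})$ are singular ($\nu\perp\bar\nu$) if there exists $A\in\mathcal{E}$ with $\nu(A)=1$ and $\bar\nu(A)=0$; otherwise they are non-singular ($\nu\not\perp\bar\nu$). $\|\nu-\bar\nu\|$ is the total variation of the signed measure $\nu-\bar\nu$ (so it takes values in $[0,2]$, with value $2$ exactly when $\nu\perp\bar\nu$). *)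

(* Defs.v *)
From HB Require Import structures.
From mathcomp Require Import all_boot all_order all_algebra.
From mathcomp Require Import all_classical all_reals all_analysis.

Set Implicit Arguments.
Unset Strict Implicit.
Unset Printing Implicit Defensive.

Import Order.TTheory GRing.Theory Num.Theory.
Import numFieldNormedType.Exports.

Local Open Scope classical_set_scope.
Local Open Scope ring_scope.
Local Open Scope ereal_scope.

Definition countably_generated d (T : measurableType d) : Prop :=
  exists G : set_system T, countable G /\ @measurable d T = <<s G >>.

(* The value at a point of a probability kernel, with its canonical structure
   of probability measure. *)
Section kernel_at.
Context d d' (X : measurableType d) (Y : measurableType d') (R : realType).
Variables (k : R.-pker X ~> Y) (x : X).

Definition kernel_at : set Y -> \bar R := k x.

HB.instance Definition _ := Measure.on kernel_at.

Let kernel_atT : kernel_at [set: Y] = 1.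
Proof. exact: prob_kernel. Qed.

HB.instance Definition _ := Measure_isProbability.Build _ _ _
  kernel_at kernel_atT.

End kernel_at.

(* The library only provides the composition of subprobability kernels. *)
Section pkcomp.
Context d0 d1 d2 (T0 : measurableType d0) (T1 : measurableType d1)
  (T2 : measurableType d2) (R : realType).
Variables (k1 : R.-pker T0 ~> T1) (k2 : R.-pker T1 ~> T2).

Definition pkcomp : T0 -> {measure set T2 -> \bar R} := mkcomp_noparam k1 k2.

HB.instance Definition _ := SubProbabilityKernel.on pkcomp.

Let pkcompT x : pkcomp x [set: T2] = 1.
Proof.
rewrite /pkcomp /mkcomp_noparam /= /kcomp_noparam.
under eq_integral do rewrite prob_kernel.
by rewrite integral_cst// mul1e prob_kernel.
Qed.

HB.instance Definition _ := isProbabilityKernel.Build _ _ _ _ _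
  pkcomp pkcompT.

End pkcomp.

(* P_0(x, A) = \d_x A and P_(n+1)(x, A) = \int P_n(x, dy) P(y, A). *)
Fixpoint nstep d (E : measurableType d) (R : realType) (P : R.-pker E ~> E)
    (n : nat) : R.-pker E ~> E :=
  if n is m.+1 then pkcomp (nstep P m) P else kdirac (@measurable_id _ E setT).

Definition invariant_probability d (E : measurableType d) (R : realType)
    (P : R.-pker E ~> E) (mu : probability E R) : Prop :=
  forall A, measurable A -> mu A = \int[mu]_x P x A.

Definition singular d (E : measurableType d) (R : realType)
    (nu nubar : probability E R) : Prop :=
  exists A : set E, [/\ measurable A, nu A = 1 & nubar A = 0].

(* The total mass of the variation of a charge. The library's
   [charge_variation] is relative to a Hahn decomposition; by
   [total_variation_chargeE] the one chosen here is irrelevant. *)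
Section total_variation_charge.
Context d (T : measurableType d) (R : realType).
Variable nu : {charge set T -> \bar R}.

Lemma hahn_decomposition_pair :
  exists PN : set T * set T, hahn_decomposition nu PN.1 PN.2.
Proof. by have [P [N nuPN]] := Hahn_decomposition nu; exists (P, N). Qed.

Definition total_variation_charge : \bar R :=
  charge_variation (projT2 (cid hahn_decomposition_pair)) [set: T].

Lemma total_variation_chargeE (P N : set T)
    (nuPN : hahn_decomposition nu P N) :
  total_variation_charge = charge_variation nuPN [set: T].
Proof.
rewrite /total_variation_charge; case: cid => -[P' N'] /= nuPN'.
rewrite /charge_variation !jordan_posE !jordan_negE !cjordan_posE !cjordan_negE.
rewrite /crestr0 mem_set// /crestr.
by have [-> ->] := Hahn_decomposition_uniq nuPN' nuPN measurableT.
Qed.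

End total_variation_charge.

Definition tv_distance d (T : measurableType d) (R : realType)
    (nu nubar : probability T R) : \bar R :=
  total_variation_charge
    (cadd (charge_of_finite_measure nu)
          (copp (charge_of_finite_measure nubar))).

(* Main.v *)
Require Import Defs.
From HB Require Import structures.
From mathcomp Require Import all_boot all_order all_algebra.
From mathcomp Require Import all_classical all_reals all_analysis.
From mathcomp Require Import measurable_realfun giry ring lra.

Set Implicit Arguments.
Unset Strict Implicit.
Unset Printing Implicit Defensive.

Import Order.TTheory GRing.Theory Num.Theory.
Import numFieldNormedType.Exports.

Local Open Scope classical_set_scope.
Local Open Scope ring_scope.
Local Open Scope ereal_scope.

(* Let D_n(x, y) = sup_A (P_n(x, A) - P_n(y, A)), half the total variation
   distance of P_n(x, .) and P_n(y, .); it decreases in n to some h(x, y), and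
   non-singularity at one n gives h(x, y) < 1. Removing the common part of
   P_n(x, .) and P_n(y, .) leaves measures a <= P_n(x, .) and b <= P_n(y, .) of
   mass D_n(x, y) with the same difference, so that
   D_(n+k)(x, y) D_n(x, y) <= \int D_k d(a x b) for every k. Letting k tend to
   infinity and using h <= (1 - e) + e 1_{h >= 1 - e},
     h D_n <= (1 - e) D_n^2 + e (P_n(x, .) x P_n(y, .))(h >= 1 - e).
   Integrating against the invariant measure mu x mu and letting n tend to
   infinity, \int h^2 <= (1 - e) \int h^2 + e (mu x mu)(h >= 1 - e), that is
   \int h^2 <= (mu x mu)(h >= 1 - e). As e tends to 0 the right-hand side tends
   to (mu x mu)(h = 1) = 0, so h = 0 almost everywhere, and the theorem follows
   from sup_A (P_n(x, A) - mu(A)) <= \int D_n(x, y) mu(dy). *)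

(** * Approximation of measurable sets by a countable algebra *)

Section countably_generated_dense.
Context d (T : measurableType d) (R : realType).

(* A node denotes the intersection of the complements of its children, so that
   these sets form the algebra generated by the [g n]. *)
Fixpoint algebra_of (g : nat -> set T) (t : GenTree.tree nat) : set T :=
  match t with
  | GenTree.Leaf n => g n
  | GenTree.Node _ ts => foldr (fun t A => ~` algebra_of g t `&` A) setT ts
  end.

Lemma measurable_algebra_of (g : nat -> set T) (t : GenTree.tree nat) :
  (forall n, measurable (g n)) -> measurable (algebra_of g t).
Proof.
move=> mg; move: t; fix IH 1 => -[n|k ts]; first exact: mg.
elim: ts => [|t ts IHts] /=; first exact: measurableT.
by apply: measurableI => //; apply: measurableC; exact: IH.
Qed.

(** Continuity from above: the differences decrease to the empty set and [m] is finite. *)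
Lemma measure_bigcup_setD_lt (m : {measure set T -> \bar R})
    (F : nat -> set T) (e : R) :
  m [set: T] < +oo -> (0 < e)%R -> (forall n, measurable (F n)) ->
  {homo F : n m / (n <= m)%N >-> (n <= m)%O} ->
  exists n, m (\bigcup_n F n `\` F n) < e%:E.
Proof.
move=> mfin e0 mF ndF; have mU := bigcup_measurable (fun n (_ : setT n) => mF n).
pose G n := \bigcup_n F n `\` F n.
have mG n : measurable (G n) by exact: measurableD.
have G0 : \bigcap_n G n = set0.
  rewrite -subset0 => x Gx; have [[n _ Fnx] _] := Gx 0%N Logic.I.
  by have [_] := Gx n Logic.I.
have niG : {homo G : n m / (n <= m)%N >-> (m <= n)%O}.
  move=> n p np; apply/subsetPset; apply: setDS; apply/subsetPset; exact: ndF.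
have : m (G n) @[n --> \oo] --> m set0.
  rewrite -G0; apply: nonincreasing_cvg_mu => //.
  - by apply: le_lt_trans mfin; apply: le_measure; rewrite ?inE.
  - by rewrite G0; exact: measurable0.
rewrite measure0 => cG.
have niGm : nonincreasing_seq (fun n => m (G n)).
  move=> n p np; apply: le_measure; rewrite ?inE//.
  by apply/subsetPset; exact: niG.
have inf0 : ereal_inf (range (fun n => m (G n))) = 0.
  exact: cvg_unique (ereal_nonincreasing_cvgn niGm) cG.
have /ereal_inf_lt[_ [n _ <-] ?] : ereal_inf (range (fun n => m (G n))) < e%:E.
  by rewrite inf0 lte_fin.
by exists n.
Qed.

(** The sets that the generated algebra approximates in [m]-measure form a lambda-system containing
    that algebra, which is stable under intersection, so they include the whole sigma-algebra. The
    family [B] is chosen before [m]: one countable family serves all finite measures at once, which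
    is what makes [step_diff] measurable. *)
Lemma countably_generated_dense :
  countably_generated T ->
  exists B : nat -> set T, (forall n, measurable (B n)) /\
    forall (m : {measure set T -> \bar R}) (A : set T) (e : R),
      m [set: T] < +oo -> measurable A -> (0 < e)%R -> exists n, m (A `+` B n) < e%:E.
Proof.
move=> [G [/countable_injP[f finj] GE]].
(* By injectivity of [f] on [G], the union has at most one member: [g n] is the generator with code
   [n], and empty if there is none. *)
pose g n := \bigcup_(A in [set A | G A /\ f A = n]) A.
have gf A : G A -> g (f A) = A.
  move=> GA; apply/seteqP; split => [x [B [GB fBA] Bx]|x Ax]; last by exists A.
  by rewrite -(finj _ _ _ _ fBA)// inE.
have mg n : measurable (g n).
  have [[A [GA <-]]|noA] := pselect (exists A, G A /\ f A = n).
    by rewrite gf// GE; exact: sub_sigma_algebra.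
  rewrite (_ : g n = set0)//; apply/seteqP; split => // x [A ? _].
  by apply: noA; exists A.
(* Trees are countable, so decoding integers enumerates the algebra; an integer that codes no tree
   yields the empty set. *)
pose B n := oapp (algebra_of g) set0 (unpickle n).
have Bt t : B (pickle t) = algebra_of g t by rewrite /B pickleK.
have mB n : measurable (B n).
  by rewrite /B; case: unpickle => //= t; exact: measurable_algebra_of.
exists B; split => // m A e mfin mA e0.
pose D := [set A | measurable A /\
  forall e : R, (0 < e)%R -> exists t, m (A `+` algebra_of g t) < e%:E].
suff [_ /(_ _ e0)[t ht]] : D A by exists (pickle t); rewrite Bt.
have mY (X Y : set T) : measurable X -> measurable Y -> measurable (X `+` Y).
  by move=> mX mY; rewrite setY_def; apply: measurableU; exact: measurableD.
have mt t : measurable (algebra_of g t) by exact: measurable_algebra_of.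
have lamD : lambda_system setT D.
  split => //.
  (* The node without children denotes the whole space. *)
  - split => // r r0; exists (GenTree.Node 0 [::]) => /=.
    by rewrite setYK measure0 lte_fin.
  - move=> X Y YX [mX hX] [mY' hY]; split; first exact: measurableD.
    move=> r r0; have r20 : (0 < r / 2)%R by rewrite divr_gt0.
    have [t ht] := hX _ r20; have [u hu] := hY _ r20.
    (* A node with one child is a complement, so this tree denotes the set of [t] minus the set of
       [u]. *)
    exists (GenTree.Node 0 [:: GenTree.Node 0 [:: t]; u]) => /=.
    rewrite !setIT setCK -setDE [r]splitr EFinD.
    apply: le_lt_trans (lteD ht hu).
    apply: (@le_trans _ _ (m ((X `+` algebra_of g t) `|` (Y `+` algebra_of g u)))).
      apply: le_measure; rewrite ?inE.
      + by apply: mY; exact: measurableD.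
      + by apply: measurableU; exact: mY.
      + move=> x /=; have [] := pselect (algebra_of g t x);
        have [] := pselect (algebra_of g u x); have [] := pselect (X x);
        have [] := pselect (Y x); tauto.
    by apply: measureU2; exact: mY.
  - move=> F ndF DF.
    have mF n : measurable (F n) by have [] := DF n.
    have mU : measurable (\bigcup_n F n) by exact: bigcup_measurable.
    split => // r r0; have r20 : (0 < r / 2)%R by rewrite divr_gt0.
    (* Half of the error goes into stopping the increasing union at [F n], the other half into
       approximating [F n]. *)
    have [n hn] := measure_bigcup_setD_lt mfin r20 mF ndF.
    have [t ht] := (DF n).2 _ r20.
    exists t; rewrite [r]splitr EFinD.
    apply: le_lt_trans (lteD hn ht).
    apply: (@le_trans _ _ (m ((\bigcup_n F n `\` F n) `|` (F n `+` algebra_of g t)))).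
      apply: le_measure; rewrite ?inE.
      + exact: mY.
      + by apply: measurableU; [exact: measurableD|exact: mY].
      + move=> x [[Ux Nx]|[tx Nx]].
          by have [Fx|Fx] := pselect (F n x); [right; left|left].
        by right; right; split => // Fx; apply: Nx; exists n.
    by apply: measureU2; [exact: measurableD|exact: mY].
have algI : setI_closed (range (algebra_of g)).
  move=> _ _ [t _ <-] [u _ <-].
  exists (GenTree.Node 0 [:: GenTree.Node 0 [:: t]; GenTree.Node 0 [:: u]]) => //=.
  by rewrite !setIT !setCK.
have algD : range (algebra_of g) `<=` D.
  move=> _ [t _ <-]; split => // r r0; exists t.
  by rewrite setYK measure0 lte_fin.
apply: (lambda_system_subset algI lamD algD) => //.
move: mA; rewrite GE; apply: sub_sigma_algebra2 => X GX.
by exists (GenTree.Leaf (f X)) => //=; exact: gf.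
Qed.

End countably_generated_dense.

(** * Largest difference of two probabilities and their common part *)

Section supdiff.
Context d (T : measurableType d) (R : realType).
Implicit Types nu rho : probability T R.

(** No absolute value is taken: passing to the complement of [A] changes the sign of the
    difference. *)
Definition supdiff nu rho : \bar R :=
  ereal_sup [set nu A - rho A | A in [set A | measurable A]].

Lemma supdiff_ge nu rho A : measurable A -> nu A - rho A <= supdiff nu rho.
Proof. by move=> mA; apply: ereal_sup_ubound; exists A. Qed.

Lemma supdiff_ge0 nu rho : 0 <= supdiff nu rho.
Proof. by have := supdiff_ge nu rho measurable0; rewrite !measure0 sube0. Qed.

Lemma supdiff_le1 nu rho : supdiff nu rho <= 1.
Proof.
apply: ge_ereal_sup => _ [A mA <-]; rewrite leeBlDr ?fin_num_measure//.
by rewrite (le_trans (probability_le1 _ mA))// leeDl.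
Qed.

Lemma supdiff_fin_num nu rho : supdiff nu rho \is a fin_num.
Proof.
by rewrite ge0_fin_numE ?supdiff_ge0// (le_lt_trans (supdiff_le1 _ _))// ltry.
Qed.

(** Replacing [A] by [B n] changes the difference by at most the mass of the symmetric difference
    under [nu + rho], so density is applied to that sum. *)
Lemma supdiff_dense nu rho (B : nat -> set T) :
  (forall n, measurable (B n)) ->
  (forall (m : {measure set T -> \bar R}) (A : set T) (e : R),
    m [set: T] < +oo -> measurable A -> (0 < e)%R ->
    exists n, m (A `+` B n) < e%:E) ->
  supdiff nu rho = ereal_sup (range (fun n => nu (B n) - rho (B n))).
Proof.
move=> mB denseB; apply/eqP; rewrite eq_le; apply/andP; split; last first.
  by apply: ge_ereal_sup => _ [n _ <-]; exact: supdiff_ge.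
apply: ge_ereal_sup => _ [A mA <-]; apply/lee_addgt0Pr => e e0.
have mfin : measure_add nu rho [set: T] < +oo.
  rewrite measure_addE [X in X + _](probability_setT nu).
  by rewrite [X in _ + X](probability_setT rho) -EFinD ltry.
have [n hn0] := denseB _ A e mfin mA e0.
have hn : nu (A `+` B n) + rho (A `+` B n) < e%:E.
  by rewrite -measure_addE; exact: hn0.
have mY : measurable (A `+` B n).
  by rewrite setY_def; apply: measurableU; exact: measurableD.
have nuA : nu A <= nu (B n) + nu (A `+` B n).
  apply: le_trans (measureU2 _ _ mY) => //; apply: le_measure; rewrite ?inE//.
    exact: measurableU.
  by move=> x Ax; have [Bx|Bx] := pselect (B n x); [left|right; left].
have rhoB : rho (B n) <= rho A + rho (A `+` B n).
  apply: le_trans (measureU2 _ _ mY) => //; apply: le_measure; rewrite ?inE//.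
    exact: measurableU.
  by move=> x Bx; have [Ax|Ax] := pselect (A x); [left|right; right].
have ub := @ereal_sup_ubound R (range (fun n => nu (B n) - rho (B n))) _
  (ex_intro2 _ _ n I erefl).
apply: le_trans (leeD ub (lexx e%:E)).
move: nuA rhoB hn.
rewrite -[nu A]fineK ?fin_num_measure// -[rho A]fineK ?fin_num_measure//.
rewrite -[nu (B n)]fineK ?fin_num_measure// -[rho (B n)]fineK ?fin_num_measure//.
rewrite -[nu (A `+` _)]fineK ?fin_num_measure//.
rewrite -[rho (A `+` _)]fineK ?fin_num_measure//.
rewrite -!EFinD !lee_fin lte_fin; lra.
Qed.

(** With [(P, N)] a Hahn decomposition of [nu - rho], [a] and [b] are its Jordan parts and [c] is
    the minimum of [nu] and [rho], namely [nu] on [N] plus [rho] on [P]. The supremum is attained at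
    [P]. *)
Lemma common_part nu rho : exists (a b : {finite_measure set T -> \bar R})
    (c : {measure set T -> \bar R}),
  [/\ forall A, measurable A -> nu A = a A + c A,
      forall A, measurable A -> rho A = b A + c A,
      a [set: T] = supdiff nu rho, b [set: T] = supdiff nu rho &
      exists2 P, measurable P & supdiff nu rho = nu P - rho P].
Proof.
pose ch : {charge set T -> \bar R} := cadd (charge_of_finite_measure nu)
          (copp (charge_of_finite_measure rho)).
have [P [N chPN]] := Hahn_decomposition ch.
have [[mP P0] [mN N0] PN PN0] := chPN.
pose a := jordan_pos chPN.
pose b := jordan_neg chPN.
pose c := measure_add (mrestr nu mN) (mrestr rho mP).
have split_measure (m : probability T R) A : measurable A ->
    m A = m (A `&` P) + m (A `&` N).
  move=> mA; rewrite -measureU//; [|exact: measurableI|exact: measurableI|].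
  - by rewrite -setIUr PN setIT.
  - by rewrite setIACA PN0 setI0.
have fin (m : probability T R) A B : measurable A -> measurable B ->
    m (A `&` B) \is a fin_num.
  by move=> mA mB; rewrite fin_num_measure//; exact: measurableI.
have aE A : measurable A -> a A = nu (A `&` P) - rho (A `&` P).
  by move=> mA; rewrite /a jordan_posE cjordan_posE /crestr0 mem_set.
have bE A : measurable A -> b A = rho (A `&` N) - nu (A `&` N).
  move=> mA; rewrite /b jordan_negE cjordan_negE /crestr0 mem_set//.
  rewrite /crestr /ch /cadd /copp /charge_of_finite_measure /=.
  by rewrite fin_num_oppeB ?fin// addeC.
have cE A : c A = nu (A `&` N) + rho (A `&` P) by rewrite /c measure_addE.
have aD A : measurable A -> nu A = a A + c A.
  move=> mA; rewrite aE// cE split_measure//.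
  rewrite -[nu (_ `&` P)]fineK ?fin// -[nu (_ `&` N)]fineK ?fin//.
  rewrite -[rho (_ `&` P)]fineK ?fin// -!EFinD; congr EFin; ring.
have bD A : measurable A -> rho A = b A + c A.
  move=> mA; rewrite bE// cE split_measure//.
  rewrite -[rho (_ `&` P)]fineK ?fin// -[rho (_ `&` N)]fineK ?fin//.
  rewrite -[nu (_ `&` N)]fineK ?fin// -!EFinD; congr EFin; ring.
have aT : a setT = supdiff nu rho.
  apply/eqP; rewrite eq_le; apply/andP; split.
    by rewrite aE// !setTI; exact: supdiff_ge.
  (* The common part cancels, leaving [a A - b A], which is at most the total mass of [a]. *)
  apply: ge_ereal_sup => _ [A mA <-]; rewrite leeBlDr ?fin_num_measure//.
  rewrite aD// bD// addeA; apply: leeD => //.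
  rewrite (@le_trans _ _ (a setT))//; last by rewrite leeDl.
  by apply: le_measure; rewrite ?inE.
exists a, b, c; split => //.
- have cfin : c setT \is a fin_num.
    rewrite ge0_fin_numE// (@le_lt_trans _ _ (nu setT))//.
      by rewrite aD// leeDr.
    by rewrite [X in X < _](probability_setT nu) ltry.
  (* Both sides are the total mass 1; cancelling the finite mass of [c] gives [a] and [b] equal
     mass. *)
  have abT : a setT + c setT = b setT + c setT.
    by rewrite -aD// -bD// [LHS](probability_setT nu) [RHS](probability_setT rho).
  by rewrite -aT -[RHS](addeK _ cfin) abT addeK.
- by exists P => //; rewrite -aT aE// !setTI.
Qed.
End supdiff.

(** * Comparison with total variation and singularity *)

Lemma tv_distance_ge0 d (T : measurableType d) (R : realType)
    (nu rho : probability T R) : 0 <= tv_distance nu rho.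
Proof. by rewrite /tv_distance /total_variation_charge adde_ge0. Qed.

(** The positive and the negative part of [nu - rho] both have mass [nu P - rho P], since [nu] and
    [rho] have the same total mass. *)
Lemma tv_distance_le d (T : measurableType d) (R : realType)
    (nu rho : probability T R) : tv_distance nu rho <= 2%:E * supdiff nu rho.
Proof.
rewrite /tv_distance; set ch := cadd _ _.
have [P [N chPN]] := Hahn_decomposition ch.
have [[mP _] [mN _] PN PN0] := chPN.
have NE : N = ~` P.
  by apply/esym/seteqP; split=> x; [have : setT x by []; rewrite -PN => -[]|
    move=> Nx Px; have : (P `&` N) x by []; rewrite PN0].
rewrite (total_variation_chargeE chPN) /charge_variation.
have -> : jordan_pos chPN setT = nu P - rho P.
  by rewrite jordan_posE cjordan_posE /crestr0 mem_set// /crestr setTI.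
have -> : jordan_neg chPN setT = nu P - rho P.
  rewrite jordan_negE cjordan_negE /crestr0 mem_set// /crestr setTI NE.
  rewrite /ch /cadd /copp /charge_of_finite_measure /=.
  rewrite [X in - (X - _)](probability_setC nu mP).
  rewrite [X in - (_ - X)](probability_setC rho mP).
  rewrite -[nu P]fineK ?fin_num_measure// -[rho P]fineK ?fin_num_measure//.
  by rewrite -!EFinB -EFinN; congr EFin; ring.
rewrite [leRHS](_ : _ = supdiff nu rho + supdiff nu rho).
  by apply: leeD; exact: supdiff_ge.
by rewrite -mule2n mule_natl.
Qed.

(** The supremum is attained at some [P], and a difference of two numbers in [0, 1] equals 1 only
    for 1 and 0. *)
Lemma supdiff1_singular d (T : measurableType d) (R : realType)
    (nu rho : probability T R) : supdiff nu rho = 1 -> singular nu rho.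
Proof.
have [_ [_ [_ [_ _ _ _ [P mP ->]]]]] := common_part nu rho.
have /fineK nuP : nu P \is a fin_num by rewrite fin_num_measure.
have /fineK rhoP : rho P \is a fin_num by rewrite fin_num_measure.
move=> nr; exists P; split => //; move: nr (probability_le1 nu mP);
  have : 0 <= rho P by []; rewrite -nuP -rhoP -EFinB !lee_fin => r0 [nr n1];
  congr EFin; lra.
Qed.

(** * Integration of kernels and bounded convergence *)

(** The hypothesis on [rho] says that it is the bind of [m] and [k] in the Giry monad, whose
    integration formula is the claim. *)
Lemma integral_bind d d' (X : measurableType d) (Y : measurableType d')
    (R : realType) (m : probability X R) (k : R.-pker X ~> Y)
    (rho : {measure set Y -> \bar R}) (f : Y -> \bar R) :
  (forall A, measurable A -> rho A = \int[m]_x k x A) ->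
  (forall y, 0 <= f y) -> measurable_fun [set: Y] f ->
  \int[rho]_y f y = \int[m]_x \int[k x]_y f y.
Proof.
move=> rhoE f0 mf.
pose K : X -> giry Y R := kernel_at k.
have mK : measurable_fun [set: X] K.
  by apply: measurable_giry_codensity => // B mB; exact: measurable_kernel.
rewrite (_ : \int[m]_x _ = giry_int (m : giry X R) (fun x => giry_int (K x) f))//.
rewrite -(giry_int_bind _ mK)//; apply: eq_measure_integral => A mA _.
rewrite rhoE//; apply/esym; rewrite /giry_bind /=.
rewrite /giry_join /= giry_int_map//; exact: measurable_giry_ev.
Qed.

Lemma cvg_bounded_integral d (T : measurableType d) (R : realType)
    (m : {measure set T -> \bar R}) (f : nat -> T -> \bar R) (g : T -> \bar R) :
  m [set: T] < +oo ->
  (forall n, measurable_fun [set: T] (f n)) ->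
  (forall n x, 0 <= f n x) -> (forall n x, f n x <= 1) ->
  (forall x, f n x @[n --> \oo] --> g x) ->
  \int[m]_x f n x @[n --> \oo] --> \int[m]_x g x.
Proof.
move=> mfin mf f0 f1 fg.
have mg : measurable_fun setT g by exact: (emeasurable_fun_cvg f).
have icst : m.-integrable setT (cst 1).
  apply/integrableP; split => //.
  under eq_integral do rewrite /= normr1.
  by rewrite integral_cst// mul1e.
have [] := @dominated_convergence _ _ _ m _ measurableT f g (cst 1) mf mg _ icst _.
- by apply: aeW => x _; exact: fg.
- by apply: aeW => x n _; rewrite gee0_abs.
- by [].
Qed.

(** * Measurability of [step_diff] and the Chapman-Kolmogorov equations *)

Section chain.
Context d (E : measurableType d) (R : realType) (P : R.-pker E ~> E).

Definition step_diff n (z : E * E) : \bar R :=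
  supdiff (kernel_at (nstep P n) z.1) (kernel_at (nstep P n) z.2).

(** The supremum may be taken over a countable family of sets that does not depend on the pair of
    starting points. *)
Lemma measurable_step_diff n :
  countably_generated E -> measurable_fun [set: E * E] (step_diff n).
Proof.
move=> /(@countably_generated_dense _ _ R) [B [mB denseB]].
rewrite (_ : step_diff n = fun z : E * E =>
    esups (fun i => nstep P n z.1 (B i) - nstep P n z.2 (B i)) 0%N).
  apply: (measurable_fun_esups
    (f := fun i (z : E * E) => nstep P n z.1 (B i) - nstep P n z.2 (B i))) => i.
  by apply: emeasurable_funB;
    apply: (measurableT_comp (measurable_kernel (nstep P n) _ (mB i))).
apply/funext => z; rewrite /step_diff (supdiff_dense _ _ mB denseB).
by congr ereal_sup; apply/seteqP; split => _ [i _ <-]; exists i.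
Qed.

Lemma measurable_nstep_integral n (f : E -> \bar R) :
  (forall x, 0 <= f x) -> measurable_fun [set: E] f ->
  measurable_fun [set: E] (fun x => \int[nstep P n x]_y f y).
Proof.
move=> f0 mf; apply: measurable_fun_integral_kernel => // U mU.
exact: measurable_kernel.
Qed.

Lemma nstepS_integral n x (f : E -> \bar R) :
  (forall x, 0 <= f x) -> measurable_fun [set: E] f ->
  \int[nstep P n.+1 x]_z f z = \int[nstep P n x]_y \int[P y]_z f z.
Proof. exact: (integral_bind (m := kernel_at (nstep P n) x)). Qed.

(** Chapman-Kolmogorov. As [nstep] adds its last step at the end, the induction on [k] absorbs one
    step of [P] into [f]. *)
Lemma nstep_add_integral n k x (f : E -> \bar R) :
  (forall x, 0 <= f x) -> measurable_fun [set: E] f ->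
  \int[nstep P (n + k) x]_z f z = \int[nstep P n x]_y \int[nstep P k y]_z f z.
Proof.
elim: k f => [|k IH] f f0 mf.
  rewrite addn0; apply: eq_integral => y _.
  by rewrite integral_dirac// diracT mul1e.
rewrite addnS nstepS_integral// IH//; last 2 first.
- by move=> y; exact: integral_ge0.
- by apply: measurable_fun_integral_kernel => // U mU; exact: measurable_kernel.
by apply: eq_integral => y _; rewrite nstepS_integral.
Qed.

Lemma nstep_add n k x A : measurable A ->
  nstep P (n + k) x A = \int[nstep P n x]_y nstep P k y A.
Proof.
move=> mA; have := @nstep_add_integral n k x (EFin \o \1_A).
rewrite integral_indic// setIT => ->.
- by apply: eq_integral => y _; rewrite integral_indic// setIT.
- by move=> y; rewrite lee_fin.
- exact/measurable_EFinP.
Qed.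

End chain.

(** * The coupling inequality *)

Section contraction.
Context d (E : measurableType d) (R : realType) (P : R.-pker E ~> E).
Hypothesis cgE : countably_generated E.
Local Notation step_diff := (step_diff P).

Lemma step_diff_ge0 n z : 0 <= step_diff n z.
Proof. exact: supdiff_ge0. Qed.

Lemma step_diff_le1 n z : step_diff n z <= 1.
Proof. exact: supdiff_le1. Qed.

(** Both chains first run [n] steps; the common part [c] of their laws contributes equally to both
    sides and cancels, so only the excess parts [a] and [b] matter for the next [k] steps. The
    measures do not depend on [k], which allows [k] to tend to infinity later. *)
Lemma step_diff_coupling n z : exists a b : {finite_measure set E -> \bar R},
  [/\ a [set: E] = step_diff n z /\ b [set: E] = step_diff n z,
      forall A, measurable A -> a A <= nstep P n z.1 A,
      forall A, measurable A -> b A <= nstep P n z.2 A,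
      forall k, step_diff (n + k) z <= step_diff n z &
      forall k, step_diff (n + k) z * step_diff n z <=
        \int[a \x b]_w step_diff k w].
Proof.
have [a [b [c [aE bE aT bT _]]]] :=
  common_part (kernel_at (nstep P n) z.1) (kernel_at (nstep P n) z.2).
suff main k : step_diff (n + k) z <= step_diff n z /\
    step_diff (n + k) z * step_diff n z <= \int[a \x b]_w step_diff k w.
  exists a, b; split => //.
  - by move=> A mA; rewrite [leRHS]aE// leeDl.
  - by move=> A mA; rewrite [leRHS]bE// leeDl.
  - by move=> k; have [] := main k.
  - by move=> k; have [] := main k.
have [_ [_ [_ [_ _ _ _ [A mA DE]]]]] :=
  common_part (kernel_at (nstep P (n + k)) z.1) (kernel_at (nstep P (n + k)) z.2).
(* [A] attains the supremum at time [n + k], so [step_diff (n + k) z] is the difference of the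
   integrals of [u] against [a] and [b]. *)
pose u y := nstep P k y A.
have u0 y : 0 <= u y by [].
have mu : measurable_fun setT u by exact: measurable_kernel.
have split_integral (m m1 m2 : {measure set E -> \bar R}) :
    (forall B, measurable B -> m B = m1 B + m2 B) ->
    \int[m]_y u y = \int[m1]_y u y + \int[m2]_y u y.
  move=> mE; rewrite -ge0_integral_measure_add//.
  apply: eq_measure_integral => B mB _; rewrite mE//.
  by apply/esym; exact: measure_addE.
have xE : nstep P (n + k) z.1 A = \int[a]_y u y + \int[c]_y u y.
  by rewrite nstep_add//; exact: (split_integral (kernel_at (nstep P n) z.1)).
have yE : nstep P (n + k) z.2 A = \int[b]_y u y + \int[c]_y u y.
  by rewrite nstep_add//; exact: (split_integral (kernel_at (nstep P n) z.2)).
have /andP[afin cfin] : (\int[a]_y u y \is a fin_num) && (\int[c]_y u y \is a fin_num).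
  by rewrite -fin_numD -xE; exact: (fin_num_measure (kernel_at (nstep P (n + k)) z.1)).
have /andP[bfin _] : (\int[b]_y u y \is a fin_num) && (\int[c]_y u y \is a fin_num).
  by rewrite -fin_numD -yE; exact: (fin_num_measure (kernel_at (nstep P (n + k)) z.2)).
have dfin : step_diff n z \is a fin_num by exact: supdiff_fin_num.
have mD := @measurable_step_diff _ _ _ P k cgE.
(* Integrate [u x <= u y + step_diff k (x, y)] against the product of [a] and [b], each of mass
   [step_diff n z]. *)
have key : step_diff n z * \int[a]_y u y <=
    step_diff n z * \int[b]_y u y + \int[a \x b]_w step_diff k w.
  rewrite fubini_tonelli1//; last exact: step_diff_ge0.
  rewrite -ge0_integralZl//; last exact: step_diff_ge0.
  have -> : step_diff n z * \int[b]_y u y = \int[a]_x (cst (\int[b]_y u y) x).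
    by rewrite integral_cst// muleC; congr (_ * _); exact: esym aT.
  have mF := @measurable_fun_fubini_tonelli_F _ _ _ _ _ b _ mD (step_diff_ge0 k).
  have F0 x : 0 <= fubini_F b (step_diff k) x.
    by apply: integral_ge0 => y _; exact: step_diff_ge0.
  rewrite -ge0_integralD//; last by move=> x _; exact: integral_ge0.
  apply: ge0_le_integral => //.
  - by move=> x _; rewrite mule_ge0// step_diff_ge0.
  - exact: measurable_funeM.
  - exact: emeasurable_funD.
  - move=> x _; rewrite /fubini_F /= -ge0_integralD//; last 2 first.
    + by move=> y _; exact: step_diff_ge0.
    + exact: measurableT_comp.
    rewrite -[X in X * _]bT muleC -integral_cst//; apply: ge0_le_integral => //.
    + by apply: emeasurable_funD => //; exact: measurableT_comp.
    move=> y _; rewrite -leeBlDl; last exact: (fin_num_measure (kernel_at _ _)).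
    exact: supdiff_ge.
rewrite [step_diff (n + k) z]DE.
rewrite [X in X - _]xE [X in _ - X]yE; split.
  (* Monotonicity: drop the integral against [b], then use [u <= 1] and the mass of [a]. *)
  apply: (@le_trans _ _ (\int[a]_y u y)).
    rewrite leeBlDr; last by rewrite fin_numD bfin cfin.
    by apply: leeD => //; rewrite leeDr// integral_ge0.
  have <- : \int[a]_y cst 1 y = step_diff n z by rewrite integral_cst// mul1e.
  apply: ge0_le_integral => // y _.
  exact: (probability_le1 (kernel_at (nstep P k) y)).
have -> : (\int[a]_y u y + \int[c]_y u y - (\int[b]_y u y + \int[c]_y u y)) *
    step_diff n z =
    step_diff n z * \int[a]_y u y - step_diff n z * \int[b]_y u y.
  rewrite -(fineK afin) -(fineK bfin) -(fineK cfin) -(fineK dfin).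
  move: (fine _) (fine _) (fine _) (fine _) => s q r p.
  apply: (congr1 EFin (_ : (p + r - (q + r)) * s = s * p - s * q)%R); ring.
by rewrite leeBlDl// fin_numM.
Qed.

End contraction.

(** * The limit of the differences and its superlevel sets *)

Section limit.
Context d (E : measurableType d) (R : realType) (P : R.-pker E ~> E).
Hypothesis cgE : countably_generated E.
Local Notation step_diff := (step_diff P).

Definition limit_diff (z : E * E) : \bar R :=
  ereal_inf (range (step_diff ^~ z)).

Lemma step_diff_nonincreasing z : nonincreasing_seq (step_diff ^~ z).
Proof.
move=> n m nm; rewrite -(subnKC nm).
by have [_ [_ [_ _ _ + _]]] := step_diff_coupling P cgE n z; exact.
Qed.

Lemma cvg_step_diff z : step_diff n z @[n --> \oo] --> limit_diff z.
Proof. exact: ereal_nonincreasing_cvgn (step_diff_nonincreasing z). Qed.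

Lemma limit_diff_le n z : limit_diff z <= step_diff n z.
Proof. by apply: ereal_inf_lbound; exists n. Qed.

Lemma limit_diff_ge0 z : 0 <= limit_diff z.
Proof. by apply/ereal_infP => _ [n _ <-]; exact: step_diff_ge0. Qed.

Lemma limit_diff_le1 z : limit_diff z <= 1.
Proof. exact: le_trans (limit_diff_le 0 z) (step_diff_le1 _ _ _). Qed.

Lemma measurable_limit_diff : measurable_fun [set: E * E] limit_diff.
Proof.
apply: (emeasurable_fun_cvg step_diff) => [n|z _]; last exact: cvg_step_diff.
exact: measurable_step_diff.
Qed.

Definition near_one (e : R) : set (E * E) :=
  [set w | (1 - e)%:E <= limit_diff w].

Lemma measurable_near_one e : measurable (near_one e).
Proof.
rewrite -[near_one e]setTI; apply: emeasurable_fun_c_infty => //.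
exact: measurable_limit_diff.
Qed.

(** The iterated integral is the mass of [near_one e] for two independent copies of the chain after
    [n] steps, in the form that [invariant_nstep_integral2] integrates. *)
Lemma limit_diff_coupling n z (e : R) : (0 <= e <= 1)%R ->
  limit_diff z * step_diff n z <=
  (1 - e)%:E * (step_diff n z * step_diff n z) +
  e%:E * \int[nstep P n z.2]_y \int[nstep P n z.1]_x
           (\1_(near_one e) (x, y))%:E.
Proof.
move=> /andP[e0 e1].
have [a [b [[aT bT] aP bP _ main]]] := step_diff_coupling P cgE n z.
set B := near_one e.
have mB : measurable B by exact: measurable_near_one.
have mh := measurable_limit_diff.
have Dfin : step_diff n z \is a fin_num by exact: supdiff_fin_num.
have abT : (a \x b) setT = step_diff n z * step_diff n z.
  by rewrite -setXTT product_measure1E//; congr (_ * _).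
(* Let [k] tend to infinity in the coupling inequality, with [limit_diff z] below
   [step_diff (n + k) z]. *)
apply: (@le_trans _ _ (\int[a \x b]_w limit_diff w)).
  have cvgI : \int[a \x b]_w step_diff k w @[k --> \oo] --> \int[a \x b]_w limit_diff w.
    apply: cvg_bounded_integral.
    - by rewrite [X in X < _]abT ltey_eq fin_numM.
    - by move=> k; exact: measurable_step_diff.
    - by move=> k w; exact: step_diff_ge0.
    - by move=> k w; exact: step_diff_le1.
    - by move=> w; exact: cvg_step_diff.
  apply: (cvge_to_ge cvgI); apply: nearW => k; apply: le_trans (main k).
  by apply: lee_wpmul2r; [exact: step_diff_ge0|exact: limit_diff_le].
have m1B : measurable_fun [set: E * E] (fun w => (\1_B w)%:E : \bar R).
  exact/measurable_EFinP.
apply: (@le_trans _ _ (\int[a \x b]_w ((1 - e)%:E + e%:E * (\1_B w)%:E))).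
  apply: ge0_le_integral => //.
  - by move=> w _; exact: limit_diff_ge0.
  - by apply: emeasurable_funD => //; exact: measurable_funeM.
  (* On [B] the bound is 1; off [B] the limit is below [1 - e] by definition. *)
  move=> w _; rewrite indicE; have [wB|wB] := boolP (w \in B).
    by rewrite mule1 -EFinD subrK; exact: limit_diff_le1.
  rewrite mule0 adde0; apply: ltW; rewrite ltNge; apply/negP => hw.
  by move: wB; rewrite notin_setE; exact.
rewrite ge0_integralD//; last 3 first.
- by move=> w _; rewrite lee_fin subr_ge0.
- by move=> w _; rewrite mule_ge0// lee_fin.
- exact: measurable_funeM.
apply: leeD.
  by rewrite -abT -(integral_cst (a \x b) measurableT (1 - e)%:E).
rewrite ge0_integralZl//.
apply: lee_wpmul2l; first by rewrite lee_fin.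
rewrite fubini_tonelli2//.
have m1By y : measurable_fun setT (fun x => (\1_B (x, y))%:E : \bar R).
  exact: (measurableT_comp m1B).
have mG (m : {sigma_finite_measure set E -> \bar R}) :
    measurable_fun setT (fun y => \int[m]_x (\1_B (x, y))%:E).
  exact: (@measurable_fun_fubini_tonelli_G _ _ _ _ _ m _ m1B).
(* The dominations of [a] and of [b] by the [n]-step laws are used one after the other. *)
apply: (@le_trans _ _ (\int[b]_y \int[nstep P n z.1]_x (\1_B (x, y))%:E)).
  apply: ge0_le_integral => //.
  - by move=> y _; exact: integral_ge0.
  - exact: (mG a).
  - exact: (mG (kernel_at (nstep P n) z.1)).
  - by move=> y _; exact: ge0_le_measure_integral.
apply: ge0_le_measure_integral => //.
- by move=> y; exact: integral_ge0.
- exact: (mG (kernel_at (nstep P n) z.1)).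
Qed.

End limit.

(** * Integration against the invariant product measure *)

Section invariance.
Context d (E : measurableType d) (R : realType) (P : R.-pker E ~> E).
Variable mu : probability E R.
Hypothesis cgE : countably_generated E.
Hypothesis muP : invariant_probability P mu.
Local Notation step_diff := (step_diff P).
Local Notation limit_diff := (limit_diff P).

Lemma invariant_nstep_integral n (f : E -> \bar R) :
  (forall x, 0 <= f x) -> measurable_fun [set: E] f ->
  \int[mu]_x \int[nstep P n x]_y f y = \int[mu]_x f x.
Proof.
elim: n f => [|n IH] f f0 mf.
  apply: eq_integral => y _.
  by rewrite integral_dirac// diracT mul1e.
rewrite [RHS](integral_bind (m := mu) (k := P) (rho := mu) muP f0 mf).
rewrite -[RHS]IH; last 2 first.
- by move=> y; exact: integral_ge0.
- by apply: measurable_fun_integral_kernel => // U mU; exact: measurable_kernel.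
by apply: eq_integral => x _; exact: nstepS_integral.
Qed.

(** The product of [mu] with itself is invariant for two independent copies of the chain: Tonelli
    reduces this to invariance in each coordinate. *)
Lemma invariant_nstep_integral2 n (g : E * E -> \bar R) :
  (forall z, 0 <= g z) -> measurable_fun [set: E * E] g ->
  \int[mu]_x \int[mu]_y \int[nstep P n y]_y' \int[nstep P n x]_x' g (x', y') =
  \int[mu \x mu]_z g z.
Proof.
move=> g0 mg.
transitivity (\int[mu]_x \int[nstep P n x]_x' \int[mu]_y' g (x', y')).
  apply: eq_integral => x _; rewrite invariant_nstep_integral.
  - apply/esym.
    exact: (@fubini_tonelli _ _ _ _ _ (kernel_at (nstep P n) x) mu g mg g0).
  - by move=> y; exact: integral_ge0.
  - exact: (@measurable_fun_fubini_tonelli_G _ _ _ _ _ (kernel_at (nstep P n) x) g mg g0).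
rewrite invariant_nstep_integral ?fubini_tonelli1//.
- by move=> y; exact: integral_ge0.
- exact: (@measurable_fun_fubini_tonelli_F _ _ _ _ _ mu g mg g0).
Qed.

Lemma integral_limit_diff_step (n : nat) (e : R) : (0 <= e <= 1)%R ->
  \int[mu \x mu]_z (limit_diff z * step_diff n z) <=
  (1 - e)%:E * \int[mu \x mu]_z (step_diff n z * step_diff n z) +
  e%:E * (mu \x mu) (near_one P e).
Proof.
move=> e01; have [e0 e1] := andP e01.
have mD := @measurable_step_diff _ _ _ P n cgE.
have mh := measurable_limit_diff P cgE.
have mB := measurable_near_one P cgE e.
have D0 := @step_diff_ge0 _ _ _ P n.
have h0 := @limit_diff_ge0 _ _ _ P.
set B := near_one P e.
have m1B : measurable_fun [set: E * E] (fun w => (\1_B w)%:E : \bar R).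
  exact/measurable_EFinP.
have DD0 z : 0 <= step_diff n z * step_diff n z by rewrite mule_ge0.
have mDD : measurable_fun setT (fun z => step_diff n z * step_diff n z).
  exact: emeasurable_funM.
have hD0 z : 0 <= limit_diff z * step_diff n z by rewrite mule_ge0.
have mhD : measurable_fun setT (fun z => limit_diff z * step_diff n z).
  exact: emeasurable_funM.
pose K x y := \int[nstep P n y]_y' \int[nstep P n x]_x' (\1_B (x', y'))%:E.
have K0 x y : 0 <= K x y by apply: integral_ge0 => ? _; exact: integral_ge0.
have mK x : measurable_fun setT (K x).
  apply: measurable_nstep_integral => [y|]; first exact: integral_ge0.
  exact: (@measurable_fun_fubini_tonelli_G _ _ _ _ _
    (kernel_at (nstep P n) x) _ m1B).
have mIK : measurable_fun setT (fun x => \int[mu]_y K x y).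
  (* By invariance in the second coordinate this is the [n]-step integral of a single measurable
     function, hence measurable in [x]. *)
  rewrite (_ : (fun x => _) =
    fun x => \int[nstep P n x]_x' \int[mu]_y' (\1_B (x', y'))%:E).
    apply: measurable_nstep_integral => [y|]; first exact: integral_ge0.
    exact: (@measurable_fun_fubini_tonelli_F _ _ _ _ _ mu _ m1B).
  apply/funext => x; rewrite invariant_nstep_integral.
  - apply/esym.
    exact: (@fubini_tonelli _ _ _ _ _ (kernel_at (nstep P n) x) mu _ m1B).
  - by move=> y; exact: integral_ge0.
  - exact: (@measurable_fun_fubini_tonelli_G _ _ _ _ _
      (kernel_at (nstep P n) x) _ m1B).
have -> : (mu \x mu) B = \int[mu]_x \int[mu]_y K x y.
  transitivity (\int[mu \x mu]_z (\1_B z)%:E); last first.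
    by apply/esym; apply: (invariant_nstep_integral2 n _ m1B).
  by rewrite integral_indic// setIT.
have mIDD : measurable_fun setT
    (fun x => \int[mu]_y (step_diff n (x, y) * step_diff n (x, y))).
  exact: (@measurable_fun_fubini_tonelli_F _ _ _ _ _ mu _ mDD).
rewrite !fubini_tonelli1//.
rewrite -!ge0_integralZl ?lee_fin ?subr_ge0//; last 2 first.
- by move=> x _; exact: integral_ge0.
- by move=> x _; exact: integral_ge0.
rewrite -ge0_integralD//; last 4 first.
- by move=> x _; rewrite mule_ge0 ?lee_fin ?subr_ge0//; exact: integral_ge0.
- exact: measurable_funeM.
- by move=> x _; rewrite mule_ge0 ?lee_fin//; exact: integral_ge0.
- exact: measurable_funeM.
apply: ge0_le_integral => //.
- by move=> x _; exact: integral_ge0.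
- exact: (@measurable_fun_fubini_tonelli_F _ _ _ _ _ mu _ mhD).
- by apply: emeasurable_funD; exact: measurable_funeM.
move=> x _; rewrite /fubini_F.
have mDDx : measurable_fun setT (fun y => step_diff n (x, y) * step_diff n (x, y)).
  exact: (measurableT_comp mDD).
rewrite -!ge0_integralZl ?lee_fin ?subr_ge0//.
rewrite -ge0_integralD//; last 4 first.
- by move=> y _; rewrite mule_ge0 ?lee_fin ?subr_ge0.
- exact: measurable_funeM.
- by move=> y _; rewrite mule_ge0 ?lee_fin.
- exact: measurable_funeM.
apply: ge0_le_integral => //.
- exact: (measurableT_comp mhD).
- by apply: emeasurable_funD; exact: measurable_funeM.
by move=> y _; exact: (limit_diff_coupling P cgE n (x, y) e01).
Qed.

End invariance.

(** * Vanishing of the limit almost everywhere *)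

Section vanishing.
Context d (E : measurableType d) (R : realType) (P : R.-pker E ~> E).
Variable mu : probability E R.
Hypothesis cgE : countably_generated E.
Hypothesis muP : invariant_probability P mu.
Local Notation step_diff := (step_diff P).
Local Notation limit_diff := (limit_diff P).

Let limit_diff_fin_num z : limit_diff z \is a fin_num.
Proof.
by rewrite ge0_fin_numE ?limit_diff_ge0// (le_lt_trans (limit_diff_le1 P z)) ?ltry.
Qed.

Let product_setT : (mu \x mu) [set: E * E] = 1.
Proof.
by rewrite -setXTT product_measure1E// [X in X * _](probability_setT mu) mul1e
  [LHS](probability_setT mu).
Qed.

Let product_fin : (mu \x mu) [set: E * E] < +oo.
Proof. by rewrite product_setT ltry. Qed.

Let measurable_sqr :
  measurable_fun [set: E * E] (fun z => limit_diff z * limit_diff z).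
Proof. by apply: emeasurable_funM; exact: measurable_limit_diff. Qed.

Let sqr_ge0 z : 0 <= limit_diff z * limit_diff z.
Proof. by rewrite mule_ge0// limit_diff_ge0. Qed.

Let mul_le1 (x y : \bar R) : 0 <= x -> 0 <= y -> x <= 1 -> y <= 1 -> x * y <= 1.
Proof. by move=> x0 y0 x1 y1; rewrite -[leRHS]mule1 lee_pmul. Qed.

(** As [n] tends to infinity both integrals in [integral_limit_diff_step] tend to the same finite
    [S], so [S <= (1 - e) S + e m] with [m] the mass of [near_one P e]; subtract and divide by
    [e]. *)
Lemma integral_sqr_limit_diff_le (e : R) : (0 < e <= 1)%R ->
  \int[mu \x mu]_z (limit_diff z * limit_diff z) <= (mu \x mu) (near_one P e).
Proof.
move=> /andP[e0 e1].
have mB := measurable_near_one P cgE e.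
have mD n := @measurable_step_diff _ _ _ P n cgE.
have mh := measurable_limit_diff P cgE.
have cvg_hD : \int[mu \x mu]_z (limit_diff z * step_diff n z) @[n --> \oo] -->
    \int[mu \x mu]_z (limit_diff z * limit_diff z).
  apply: cvg_bounded_integral => //.
  - by move=> n; exact: emeasurable_funM.
  - by move=> n z; rewrite mule_ge0 ?limit_diff_ge0 ?step_diff_ge0.
  - by move=> n z; rewrite mul_le1 ?limit_diff_ge0 ?step_diff_ge0
      ?limit_diff_le1 ?step_diff_le1.
  - by move=> z; apply: cvgeZl => //; exact: cvg_step_diff.
have cvg_DD : \int[mu \x mu]_z (step_diff n z * step_diff n z) @[n --> \oo] -->
    \int[mu \x mu]_z (limit_diff z * limit_diff z).
  apply: cvg_bounded_integral => //.
  - by move=> n; exact: emeasurable_funM.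
  - by move=> n z; rewrite mule_ge0 ?step_diff_ge0.
  - by move=> n z; rewrite mul_le1 ?step_diff_ge0 ?step_diff_le1.
  - move=> z; apply: cvgeM; [|exact: cvg_step_diff|exact: cvg_step_diff].
    exact: mule_def_fin.
set S := \int[_]_z _ in cvg_hD cvg_DD *.
have Bfin : (mu \x mu) (near_one P e) \is a fin_num.
  rewrite ge0_fin_numE//; apply: le_lt_trans product_fin.
  by apply: le_measure; rewrite ?inE.
have S0 : 0 <= S by exact: integral_ge0.
have Sfin : S \is a fin_num.
  rewrite ge0_fin_numE//; apply: le_lt_trans product_fin.
  rewrite -[leRHS]mul1e -(integral_cst _ measurableT 1).
  apply: ge0_le_integral => // z _.
  by rewrite mul_le1 ?limit_diff_ge0 ?limit_diff_le1.
have : S <= (1 - e)%:E * S + e%:E * (mu \x mu) (near_one P e).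
  apply: (lee_cvg_to cvg_hD (g := fun n =>
    (1 - e)%:E * \int[mu \x mu]_z (step_diff n z * step_diff n z) +
    e%:E * (mu \x mu) (near_one P e))).
    apply: cvgeD; [by rewrite fin_num_adde_defl// fin_numM| |exact: cvg_cst].
    exact: cvgeZl.
  apply: nearW => n; apply: integral_limit_diff_step => //.
  by rewrite (ltW e0).
rewrite -(fineK Sfin) -(fineK Bfin) -!EFinM -EFinD !lee_fin.
by move=> h; rewrite -(ler_pM2l e0); lra.
Qed.

(** The sets [near_one] decrease, as [e] tends to 0, to the null set where the limit equals 1. *)
Lemma integral_sqr_limit_diff_eq0 :
  {ae (mu \x mu), forall z : E * E, limit_diff z < 1} ->
  \int[mu \x mu]_z (limit_diff z * limit_diff z) = 0.
Proof.
move=> lt1; apply/eqP; rewrite eq_le integral_ge0// andbT.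
(* The shift by one keeps [e n] in (0, 1] from [n = 0] on. *)
pose e n : R := (n.+1%:R^-1)%R.
pose B n := near_one P (e n).
have mB n : measurable (B n) by exact: measurable_near_one.
have mI : measurable (\bigcap_n B n) by exact: bigcapT_measurable.
have I0 : (mu \x mu) (\bigcap_n B n) = 0.
  apply/negligibleP => //; apply: negligibleS lt1 => z Bz /=.
  apply/negP; rewrite -leNgt; apply/lee_addgt0Pr => r r0.
  have [n nr] : exists n, (e n < r)%R.
    by have [n _ /(_ n (leqnn n))] := near_infty_natSinv_lt (PosNum r0); exists n.
  have := Bz n I; rewrite /B /near_one /= => h.
  rewrite -leeBlDr//; apply: le_trans h; rewrite -EFinB lee_fin; lra.
have niB : {homo B : n m / (n <= m)%N >-> (m <= n)%O}.
  move=> n m nm; apply/subsetPset => z; rewrite /B /near_one /=; apply: le_trans.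
  by rewrite lee_fin lerB// lef_pV2 ?posrE// ler_nat.
have cvgB : (mu \x mu) (B n) @[n --> \oo] --> 0.
  rewrite -I0; apply: nonincreasing_cvg_mu => //.
  by apply: le_lt_trans product_fin; apply: le_measure; rewrite ?inE.
apply: (cvge_to_ge cvgB); apply: nearW => n.
apply: integral_sqr_limit_diff_le.
by rewrite invr_gt0 ltr0n /= invf_le1// ler1n.
Qed.

(** A nonnegative function with null integral vanishes almost everywhere. This is applied to the
    square on the product space and then, after Tonelli, to the inner integral as a function of
    [x]. *)
Lemma ae_integral_limit_diff_eq0 :
  {ae (mu \x mu), forall z : E * E, limit_diff z < 1} ->
  {ae mu, forall x, \int[mu]_y limit_diff (x, y) = 0}.
Proof.
move=> /integral_sqr_limit_diff_eq0 hh0.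
have mh := measurable_limit_diff P cgE.
have h0 := @limit_diff_ge0 _ _ _ P.
have ae_hh : ae_eq (mu \x mu) setT (fun z => limit_diff z * limit_diff z) (cst 0).
  apply/ae_eq_integral_abs => //; rewrite -[RHS]hh0.
  by apply: eq_integral => z _; rewrite gee0_abs.
have ae_h : ae_eq (mu \x mu) setT limit_diff (cst 0).
  apply: filterS ae_hh => z /= /(_ I) /eqP; rewrite mule_eq0 orbb => /eqP h _.
  exact: h.
have : \int[mu \x mu]_z limit_diff z = 0.
  by rewrite (ae_eq_integral _ _ _ _ _ ae_h)// integral0.
rewrite fubini_tonelli1// => int0.
have : ae_eq mu setT (fubini_F mu limit_diff) (cst 0).
  apply/ae_eq_integral_abs => //.
    exact: (@measurable_fun_fubini_tonelli_F _ _ _ _ _ mu _ mh).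
  rewrite -[RHS]int0; apply: eq_integral => x _; rewrite gee0_abs//.
  exact: integral_ge0.
by apply: filterS => x /(_ I).
Qed.

Lemma tv_distance_invariant_le n x :
  tv_distance (kernel_at (nstep P n) x) mu <=
  2%:E * \int[mu]_y step_diff n (x, y).
Proof.
apply: le_trans (tv_distance_le _ _) _.
apply: lee_wpmul2l; first by rewrite lee_fin.
apply: ge_ereal_sup => _ [A mA <-].
rewrite leeBlDr ?fin_num_measure//.
have mPA : measurable_fun setT (fun y => nstep P n y A) by exact: measurable_kernel.
have muA : mu A = \int[mu]_y nstep P n y A.
  have := invariant_nstep_integral muP n (f := EFin \o \1_A).
  rewrite integral_indic// setIT => <-.
  - by apply: eq_integral => y _; rewrite integral_indic// setIT.
  - by move=> y; rewrite lee_fin.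
  - exact/measurable_EFinP.
have mDx : measurable_fun setT (fun y => step_diff n (x, y)).
  exact: (measurableT_comp (measurable_step_diff P n cgE)).
(* With [mu A] written as the average of [nstep P n y A], the claim is the [mu]-average over [y] of
   the bound by [step_diff n (x, y)]. *)
rewrite muA -ge0_integralD//; last by move=> y _; exact: step_diff_ge0.
rewrite -[leLHS]mule1 -[X in _ * X](probability_setT mu).
rewrite -(integral_cst mu measurableT).
apply: ge0_le_integral => //.
  exact: emeasurable_funD.
move=> y _; rewrite -leeBlDr; last exact: (fin_num_measure (kernel_at _ _)).
exact: supdiff_ge.
Qed.

End vanishing.

(** * Convergence in total variation *)

Theorem theorem2 (R : realType) (d : measure_display) (E : measurableType d)
    (P : R.-pker E ~> E) (mu : probability E R) :
  countably_generated E ->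
  measurable (diagonal : set (E * E)) ->
  invariant_probability P mu ->
  {ae (mu \x mu), forall xy : E * E, exists2 n : nat, (0 < n)%N &
     ~ singular (kernel_at (nstep P n) xy.1) (kernel_at (nstep P n) xy.2)} ->
  {ae mu, forall x : E,
     tv_distance (kernel_at (nstep P n) x) mu @[n --> \oo] --> 0}.
Proof.
move=> cgE _ muP nonsing.
have : {ae (mu \x mu), forall z : E * E, limit_diff P z < 1}.
  apply: filterS nonsing => z [n _ nsing].
  (* The limit lies below each term, so a single non-singular time makes it less than 1. *)
  rewrite (le_lt_trans (limit_diff_le P n z))// lt_neqAle step_diff_le1 andbT.
  by apply/eqP => /supdiff1_singular.
move=> /(ae_integral_limit_diff_eq0 cgE muP); apply: filterS => x hx0.
have cvgD : \int[mu]_y step_diff P n (x, y) @[n --> \oo] --> 0.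
  rewrite -hx0; apply: cvg_bounded_integral.
  - by rewrite [X in X < _](probability_setT mu) ltry.
  - by move=> n; apply: (measurableT_comp (measurable_step_diff P n cgE)).
  - by move=> n y; exact: step_diff_ge0.
  - by move=> n y; exact: step_diff_le1.
  - by move=> y; exact: cvg_step_diff.
apply: (squeeze_cvge (f := cst 0)
  (h := fun n => 2%:E * \int[mu]_y step_diff P n (x, y))).
- by apply: nearW => n; rewrite tv_distance_ge0 tv_distance_invariant_le.
- exact: cvg_cst.
- by rewrite -(mule0 2%:E); exact: cvgeZl.
Qed.
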